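(* Let $n\ge 1$, and let $m\ge0$ and $2\le k\le n+1$ be integers. The arrangement of affine hyperplanes in $\mathbb{R}^n$ consisting of the hyperplanes $x_1-x_j=0,1,\ldots,m$ for $2\le j<k$, the hyperplanes $x_1-x_j=0,1,\ldots,m+1$ for $k\le j\le n$, and the hyperplanes $x_i-x_j=0$ and $x_i-x_j=1$ for $2\le i<j\le n$, has exactly $(n+m)^{k-2}(n+m+1)^{n-k+1}$ regions. In particular (taking $m=0$, $k=2$), the Shi arrangement in $\mathbb{R}^n$, consisting of the hyperplanes $x_i-x_j=0$ and $x_i-x_j=1$ for $1\le i<j\le n$, has $(n+1)^{n-1}$ regions.
   Context: A region of a finite arrangement of affine hyperplanes in $\mathbb{R}^n$ is a connected component of the complement of the union of its hyperplanes. *)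

(* Defs.v *)
From HB Require Import structures.
From mathcomp Require Import all_boot all_order all_algebra.
From mathcomp Require Import all_classical all_reals all_analysis.
Set Implicit Arguments. Unset Strict Implicit. Unset Printing Implicit Defensive.
Import Order.TTheory GRing.Theory Num.Theory.
Import numFieldTopology.Exports numFieldNormedType.Exports.
Local Open Scope classical_set_scope.
Local Open Scope ring_scope.

Definition hyperplane (R : realType) (n : nat) (h : 'rV[R]_n * R) : set 'rV[R]_n :=
  [set x | (x *m h.1^T) 0 0 = h.2].

Definition arr_complement (R : realType) (n : nat) (A : seq ('rV[R]_n * R))
  : set 'rV[R]_n :=
  [set x | forall h, h \in A -> ~ hyperplane h x].

Definition regions (R : realType) (n : nat) (A : seq ('rV[R]_n * R))
  : set (set 'rV[R]_n) :=
  [set connected_component (arr_complement A) x | x in arr_complement A].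

Definition eij (R : realType) (n : nat) (i j : 'I_n) : 'rV[R]_n :=
  delta_mx 0 i - delta_mx 0 j.

(* Constants c for the hyperplanes x_i - x_j = c (0-based coordinates):
   - i = 0 (i.e. x_1), 1 <= j < k-1 (i.e. 2 <= j+1 < k): c = 0..m
   - i = 0, j >= k-1 (i.e. k <= j+1 <= n): c = 0..m+1
   - 1 <= i < j (i.e. 2 <= i+1 < j+1 <= n): c = 0, 1 *)
Definition consts (n m k : nat) (i j : 'I_n) : seq nat :=
  if (val i == 0%N) && (0 < val j)%N then
    (if (val j < k.-1)%N then iota 0 m.+1 else iota 0 m.+2)
  else if (0 < val i)%N && (val i < val j)%N then iota 0 2
  else [::].

Definition arrangement (R : realType) (n m k : nat) : seq ('rV[R]_n * R) :=
  flatten [seq flatten [seq [seq (eij R i j, (c%:R : R)) | c <- consts m k i j]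
                         | j <- enum 'I_n] | i <- enum 'I_n].

(* Main.v *)
Require Import Defs.
From HB Require Import structures.
From mathcomp Require Import all_boot all_order all_algebra.
From mathcomp Require Import all_classical all_reals all_analysis.
From mathcomp Require Import ring lra zify.
Set Implicit Arguments. Unset Strict Implicit. Unset Printing Implicit Defensive.
Import Order.TTheory GRing.Theory Num.Theory.
Import numFieldTopology.Exports numFieldNormedType.Exports.
Local Open Scope classical_set_scope.
Local Open Scope ring_scope.

(** Deletion-restriction: adding a hyperplane [h] to an arrangement adds as many
    regions as the arrangement cuts out on [h].  Write [A n m k] for the
    arrangement of the theorem.  Adding [x_1 - x_k = m + 1] to [A n m (k + 1)]
    gives [A n m k], and restricting to this hyperplane gives [A (n - 1) (m + 1) k];
    moreover [A n m (n + 1) = A n (m - 1) 2] for [m >= 1].  This reduces everything to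
    [A n 0 (n + 1)], the Shi arrangement in [x_2, ..., x_n] together with the
    hyperplanes [x_1 = x_j].  Adding the latter one at a time, each restriction
    is again the Shi arrangement in [n - 1] coordinates, so [A n 0 (n + 1)] has
    [n] times as many regions as [A (n - 1) 0 2].

    Points are sequences [nat -> R], so that restricting to [x_i - x_j = c] only
    makes one coordinate irrelevant and never changes the ambient space. *)

(** * Signs of products and convex combinations of reals *)

Lemma mulr_gt0_trans (R : realType) (a b c : R) :
  0 < a * b -> 0 < b * c -> 0 < a * c.
Proof.
move=> ab bc; have b0 : b != 0.
  by apply: contraTneq ab => ->; rewrite mulr0 ltxx.
have := mulr_gt0 ab bc.
rewrite (_ : a * b * (b * c) = b ^+ 2 * (a * c)); last by ring.
by rewrite pmulr_rgt0 // exprn_even_gt0.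
Qed.

(** Convexity of open half-spaces, with [a] and [b] the values of an affine form at the ends of a
    segment. *)
Lemma mulr_conv_gt0 (R : realType) (a b t : R) :
  0 <= t <= 1 -> 0 < a * b -> 0 < a * ((1 - t) * a + t * b).
Proof.
move=> /andP[t0 t1] ab; have a0 : a != 0.
  by apply: contraTneq ab => ->; rewrite mul0r ltxx.
have a2 : 0 < a * a by rewrite -expr2 exprn_even_gt0.
rewrite (_ : a * ((1 - t) * a + t * b) = (1 - t) * (a * a) + t * (a * b)); last by ring.
have [->|tn0] := eqVneq t 0; first by rewrite subr0 mul1r mul0r addr0.
by apply: ltr_wpDl; [apply: mulr_ge0; rewrite ?subr_ge0 // ltW
                  |apply: mulr_gt0; rewrite // lt_def tn0].
Qed.

Lemma conv_eq0 (R : realType) (a b : R) :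
  a * b < 0 -> exists2 t, 0 <= t <= 1 & (1 - t) * a + t * b = 0.
Proof.
move=> ab; have d0 : a - b != 0.
  by apply: contraTneq ab => /subr0_eq ->; rewrite -leNgt -expr2 sqr_ge0.
have d2 : 0 < (a - b) ^+ 2 by rewrite exprn_even_gt0.
(* The affine function with values [a] at 0 and [b] at 1 vanishes here. *)
exists (a / (a - b)); last by field.
have -> : a / (a - b) = (a * (a - b)) / (a - b) ^+ 2 by field.
by rewrite ler_pdivrMr // divr_ge0 /= ?mul1r ?ltW //; nra.
Qed.

(** * Counting the classes cut out by hyperplanes *)

(** A finite system of representatives stands in for the quotient. Requiring [E x x] lets [E] be
    partial, so that points on a hyperplane belong to no class. *)
Definition class_count (T : Type) (D : T -> Prop) (E : T -> T -> Prop)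
    (N : nat) : Prop :=
  exists (I : finType) (rep : I -> T),
    [/\ #|I| = N, forall i, D (rep i) /\ E (rep i) (rep i),
        forall i j, E (rep i) (rep j) -> i = j
      & forall x, D x -> E x x -> exists i, E x (rep i)].

(* [(i, j, c)] encodes the hyperplane [x_i - x_j = c]. *)
Definition lform (R : realType) (h : nat * nat * nat) (x : nat -> R) : R :=
  x h.1.1 - x h.1.2 - h.2%:R.

(* A partial equivalence: [same_side H x x] says that [x] avoids every
   hyperplane of [H]. *)
Definition same_side (R : realType) (H : pred (nat * nat * nat))
    (x y : nat -> R) : Prop :=
  forall h, H h -> 0 < lform h x * lform h y.

Lemma same_sideC (R : realType) H (x y : nat -> R) :
  same_side H x y -> same_side H y x.
Proof. by move=> xy h Hh; rewrite mulrC; apply: xy. Qed.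

Lemma same_side_trans (R : realType) H (x y z : nat -> R) :
  same_side H x y -> same_side H y z -> same_side H x z.
Proof. by move=> xy yz h Hh; apply: mulr_gt0_trans (xy _ Hh) (yz _ Hh). Qed.

Lemma same_side_refl (R : realType) H (x y : nat -> R) :
  same_side H x y -> same_side H x x.
Proof. by move=> xy; exact: same_side_trans xy (same_sideC xy). Qed.

(** Representatives for [H], pushed into [D] by [p], represent the classes of [G] on [D]. For a
    restriction, [p] projects onto the hyperplane by overwriting a coordinate that [H] does not
    involve. *)
Lemma class_count_retract (R : realType) (D : (nat -> R) -> Prop)
    (G H : pred (nat * nat * nat)) (p : (nat -> R) -> nat -> R) (N : nat) :
  (forall x, D (p x)) -> (forall x h, H h -> lform h (p x) = lform h x) ->
  (forall x y, D x -> D y -> same_side G x y <-> same_side H x y) ->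
  class_count (fun=> True) (@same_side R H) N -> class_count D (@same_side R G) N.
Proof.
move=> Dp Hp GH [I [rep [cI repH repI repS]]].
have Gp x y : same_side G (p x) (p y) <-> same_side H x y.
  by rewrite GH //; split=> xy h Hh; move: (xy h Hh); rewrite !Hp.
exists I, (p \o rep); split => //= [i|i j|x Dx].
- by split=> //; apply/Gp; case: (repH i).
- by move=> /Gp; apply: repI.
- move=> /(GH _ _ Dx Dx) Fx; have [i xi] := repS x Logic.I Fx.
  by exists i; apply/GH => // h Hh; rewrite Hp //; apply: xi.
Qed.

Lemma eq_class_count (R : realType) (G H : pred (nat * nat * nat)) (N : nat) :
  G =1 H -> class_count (fun=> True) (@same_side R H) N ->
  class_count (fun=> True) (@same_side R G) N.
Proof.
move=> GH; apply: (class_count_retract (p := id)) => // x y _ _.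
by split=> xy h Hh; apply: xy; rewrite ?GH // -GH.
Qed.

Lemma lform_conv (R : realType) h (x y : nat -> R) (t : R) :
  lform h (fun l => (1 - t) * x l + t * y l)
  = (1 - t) * lform h x + t * lform h y.
Proof. by rewrite /lform; ring. Qed.

Lemma same_side_conv (R : realType) H (x y : nat -> R) (t : R) :
  0 <= t <= 1 -> same_side H x y ->
  same_side H x (fun l => (1 - t) * x l + t * y l).
Proof.
by move=> t01 xy h Hh; rewrite lform_conv; apply: mulr_conv_gt0 => //; apply: xy.
Qed.

(** * Perturbation of points and deletion-restriction *)

Definition shift (R : realType) (i : nat) (t : R) (x : nat -> R) : nat -> R :=
  fun l => x l + t * (l == i)%:R.

(** Finiteness of [H], expressed by [s], keeps the minimum of the absolute values positive; halving
    makes the bound strict. *)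
Lemma lform_margin (R : realType) (H : pred (nat * nat * nat))
    (s : seq (nat * nat * nat)) (x : nat -> R) :
  (forall h, H h -> h \in s) -> same_side H x x ->
  exists2 e : R, 0 < e & forall h, H h -> e < `|lform h x|.
Proof.
move=> Hs xx.
suff [e e0 es] : exists2 e : R, 0 < e & forall h, h \in s -> H h -> e < `|lform h x|.
  by exists e => // h Hh; apply: es => //; apply: Hs.
elim: s {Hs} => [|g s [e e0 es]]; first by exists 1.
have [Hg|Hg] := boolP (H g); last first.
  exists e => // h; rewrite inE => /orP[/eqP-> Hg'|]; last exact: es.
  by rewrite Hg' in Hg.
have g0 : 0 < `|lform g x|.
  by rewrite normr_gt0; apply: contraTneq (xx g Hg) => ->; rewrite mulr0 ltxx.
exists (Num.min e (`|lform g x| / 2)); first by rewrite lt_min e0 divr_gt0.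
move=> h; rewrite inE gt_min => /orP[/eqP->|hs Hh]; last by rewrite es.
by move=> _; apply/orP; right; lra.
Qed.

Lemma same_side_shift (R : realType) (H : pred (nat * nat * nat)) (x : nat -> R)
    (e t : R) (i : nat) :
  (forall h, H h -> e < `|lform h x|) -> `|t| <= e -> same_side H x (shift i t x).
Proof.
move=> He te h /He; rewrite /shift /lform.
set a := _ - _; set b := (X in _ < a * X) => ea.
(* Shifting coordinate [i] changes the form by [t] times -1, 0 or 1. *)
have [d d1 ->] : exists2 d : R, `|d| <= 1 & b = a + t * d.
  exists ((h.1.1 == i)%:R - (h.1.2 == i)%:R); last by rewrite /b /a; ring.
  by case: eqP; case: eqP => _ _; rewrite ?subrr ?subr0 ?sub0r ?normrN ?normr1 ?normr0 ?ler01.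
have : `|t * d| < `|a|.
  by rewrite normrM (le_lt_trans _ ea) // (le_trans _ te) // ler_piMr.
rewrite ltr_norml => /andP[]; case: (ltrP 0 a) => a0.
  by rewrite gtr0_norm // => lo _; rewrite mulr_gt0 //; lra.
by rewrite ler0_norm // => lo hi; rewrite nmulr_rgt0; lra.
Qed.

Lemma lform_shift (R : realType) (h : nat * nat * nat) (t : R) (x : nat -> R) :
  h.1.1 != h.1.2 -> lform h (shift h.1.1 t x) = lform h x + t.
Proof.
by rewrite eq_sym => /negbTE hn; rewrite /lform /shift eqxx hn mulr1 mulr0; ring.
Qed.

(* Each class of [H] has a representative off [h], and the classes that [h]
   meets have a second one, on the other side of [h]. *)
Lemma deletion_restriction (R : realType) (H : pred (nat * nat * nat)) h
    (s : seq (nat * nat * nat))    (N1 N2 : nat) :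
  (forall h, H h -> h \in s) -> h.1.1 != h.1.2 ->
  class_count (fun=> True) (@same_side R H) N1 ->
  class_count (fun x => lform h x = 0) (@same_side R H) N2 ->
  class_count (fun=> True) (@same_side R (predU1 h H)) (N1 + N2).
Proof.
move=> Hs hn [I [r1 [cI r1H r1I r1S]]] [J [r2 [cJ r2H r2I r2S]]].
(* A point of [h] can leave [h] to either side without crossing a hyperplane of [H]. *)
have moveP (x : nat -> R) : same_side H x x -> lform h x = 0 -> exists2 e : R, 0 < e &
    forall t, `|t| <= e -> same_side H x (shift h.1.1 t x) /\ lform h (shift h.1.1 t x) = t.
  move=> xx hx; have [e e0 He] := lform_margin Hs xx; exists e => // t te.
  by split; [exact: same_side_shift He te|rewrite lform_shift // hx add0r].
have /choice[q1 q1P] (i : I) : exists y, same_side H (r1 i) y /\ lform h y != 0.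
  have [_ ri] := r1H i; have [hx|hx] := eqVneq (lform h (r1 i)) 0; last by exists (r1 i).
  have [e e0 /(_ e)] := moveP _ ri hx; rewrite gtr0_norm // => /(_ (lexx _))[? he].
  by exists (shift h.1.1 e (r1 i)); rewrite he gt_eqF.
have q1I i j : same_side H (q1 i) (q1 j) -> i = j.
  have [ii _] := q1P i; have [jj _] := q1P j => ij; apply: r1I.
  exact: same_side_trans ii (same_side_trans ij (same_sideC jj)).
have q1S x : same_side H x x -> exists i, same_side H x (q1 i).
  move=> /(r1S x Logic.I)[i xi]; exists i; have [ii _] := q1P i.
  exact: same_side_trans xi ii.
have /choice[q2 q2P] (j : J) : exists y, same_side H (r2 j) y /\
    forall i, same_side H (q1 i) (r2 j) -> lform h (q1 i) * lform h y < 0.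
  have [hj rj] := r2H j; have [i0 ji0] := q1S _ rj.
  (* The sign of the shift puts the new point across [h] from the [q1] representative of the same
     class of [H]. *)
  have [e e0 /(_ (- e * Num.sg (lform h (q1 i0))))] := moveP _ rj hj.
  have [_ i0n] := q1P i0.
  rewrite normrM normr_sg i0n mulr1 normrN gtr0_norm // => /(_ (lexx _))[? he].
  eexists; split; first by eauto.
  move=> i ij; rewrite -(q1I _ _ (same_side_trans ij ji0)) in he i0n *.
  by rewrite he mulrCA [X in - e * X]mulrC -normrEsg mulNr oppr_lt0 mulr_gt0 // normr_gt0 //.
have subH x y : same_side (predU1 h H) x y <-> 0 < lform h x * lform h y /\ same_side H x y.
  split=> [xy|[hxy xy] g /predU1P[->//|/xy//]].
  by split=> [|g Hg]; apply: xy; rewrite /= ?eqxx // Hg orbT.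
have mul0 (a b : R) : a * b < 0 -> b != 0.
  by move=> ab; apply: contraTneq ab => ->; rewrite mulr0 ltxx.
exists (I + J)%type, (fun k => match k with inl i => q1 i | inr j => q2 j end).
have neg_neg (a b c : R) : a * b < 0 -> a * c < 0 -> 0 < b * c.
  by move=> ab ac; apply: (@mulr_gt0_trans _ _ (- a)); nra.
split=> [|k|k l|x _].
- by rewrite card_sum cI cJ.
- split=> //; apply/subH; case: k => [i|j].
    have [ii i0] := q1P i; split; last exact: same_side_refl (same_sideC ii).
    by rewrite -expr2 exprn_even_gt0.
  have [jj j0] := q2P j; split; last exact: same_side_refl (same_sideC jj).
  have [_ rj] := r2H j; have [i ji] := q1S _ rj.
  by rewrite -expr2 exprn_even_gt0 //= (mul0 _ _ (j0 i (same_sideC ji))).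
- have cross i j : ~ same_side (predU1 h H) (q1 i) (q2 j).
    move=> /subH[hij ij]; have [jj /(_ i)] := q2P j.
    by move=> /(_ (same_side_trans ij (same_sideC jj))); rewrite ltNge ltW.
  case: k l => [i|j] [i'|j'].
  + by move=> /subH[_ /q1I ->].
  + by move=> /cross.
  + by move=> /same_sideC /cross.
  + move=> /subH[_ ij]; have [j1 _] := q2P j; have [j2 _] := q2P j'; congr inr; apply: r2I.
    exact: same_side_trans j1 (same_side_trans ij (same_sideC j2)).
- move=> /subH[hx xx]; have [i xi] := q1S _ xx; have [ii i0] := q1P i.
  have x0 : lform h x != 0 by apply: contraTneq hx => ->; rewrite mulr0 ltxx.
  case: (ltrgtP 0 (lform h (q1 i) * lform h x)) => hix.
  + by exists (inl i); apply/subH; rewrite mulrC.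
  (* The segment from [q1 i] to [x] meets [h] in the class of some [r2 j]; then [x] and [q2 j] both
     lie across [h] from [q1 i]. *)
  + have [t t01 w0] := conv_eq0 hix; rewrite -lform_conv in w0.
    have iw := same_side_conv t01 (same_sideC xi).
    have [j wj] := r2S _ w0 (same_side_refl (same_sideC iw)).
    have [jj /(_ i (same_side_trans iw wj)) j0] := q2P j.
    exists (inr j); apply/subH; split; first exact: neg_neg j0.
    exact: same_side_trans xi (same_side_trans iw (same_side_trans wj jj)).
  + by move/eqP: hix; rewrite eq_sym mulf_eq0 (negbTE x0) (negbTE i0).
Qed.

(** * The arrangements of the induction, their additions and restrictions *)

(* The theorem's arrangement with [x_o] in the role of [x_1] and the other
   coordinates indexed by [L]; with 0-based indices [K] is the paper's [k - 1]. *)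
Definition ext_shi (o : nat) (L : seq nat) (m K : nat) : pred (nat * nat * nat) :=
  fun h => (h.1.2 \in L) &&
    if h.1.1 == o then (h.2 <= m + (K <= h.1.2))%N
    else [&& h.1.1 \in L, (h.1.1 < h.1.2)%N & (h.2 <= 1)%N].

(** For [o] outside [L], this interpolates between the Shi arrangement on [L] ([K = 0]) and
    [ext_shi o L 0 K] ([K] above all of [L]). *)
Definition shi_apex (o : nat) (L : seq nat) (K : nat) : pred (nat * nat * nat) :=
  fun h => (h.1.2 \in L) &&
    if h.1.1 == o then (h.1.2 < K)%N && (h.2 == 0%N)
    else [&& h.1.1 \in L, (h.1.1 < h.1.2)%N & (h.2 <= 1)%N].

(** Finite lists containing both families, as [deletion_restriction] requires. *)
Definition triples (o : nat) (L : seq nat) (b : nat) : seq (nat * nat * nat) :=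
  [seq (ij, c) | ij <- [seq (i, j) | i <- o :: L, j <- L], c <- iota 0 b].

Lemma mem_triples o L b i j c :
  i \in o :: L -> j \in L -> (c < b)%N -> (i, j, c) \in triples o L b.
Proof.
by move=> Li Lj cb; apply: allpairs_f; [apply: allpairs_f|rewrite mem_iota].
Qed.

Lemma ext_shi_triples o L m K h : ext_shi o L m K h -> h \in triples o L m.+2.
Proof.
case: h => [[i j] c]; rewrite /ext_shi /= => /andP[Lj].
case: eqP => [-> cm|_ /and3P[Li _ c1]]; apply: mem_triples; rewrite ?inE ?eqxx ?Li ?orbT //.
  by case: (K <= j)%N cm => /=; lia.
by lia.
Qed.

Lemma shi_apex_triples o L K h : shi_apex o L K h -> h \in triples o L 2.
Proof.
case: h => [[i j] c]; rewrite /shi_apex /= => /andP[Lj].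
case: eqP => [-> /andP[_ /eqP->]|_ /and3P[Li _ c1]]; apply: mem_triples;
  by rewrite ?inE ?eqxx ?Li ?orbT.
Qed.

Lemma ext_shi_addition o L m k :
  k \in L -> ext_shi o L m k =1 predU1 (o, k, m.+1) (ext_shi o L m k.+1).
Proof.
move=> Lk [[i j] c]; rewrite /= /ext_shi /= !xpair_eqE.
have [_|_] //= := eqVneq i o; have [->|jk] /= := eqVneq j k.
  by rewrite Lk leqnn ltnn /=; lia.
by rewrite ltn_neqAle eq_sym jk.
Qed.

Lemma shi_apex_addition o L k :
  k \in L -> shi_apex o L k.+1 =1 predU1 (o, k, 0%N) (shi_apex o L k).
Proof.
move=> Lk [[i j] c]; rewrite /= /shi_apex /= !xpair_eqE.
have [_|_] //= := eqVneq i o; have [->|jk] /= := eqVneq j k.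
  by rewrite Lk ltnn ltnSn /=; lia.
by rewrite ltnS leq_eqVlt (negbTE jk).
Qed.

(* On x_o = x_k + m + 1 the hyperplanes x_j - x_k = 0, 1 (j < k) become
   x_o - x_j = m + 1, m, and x_k - x_j = 0, 1 (k < j) become
   x_o - x_j = m + 1, m + 2. *)
Lemma ext_shi_restriction (R : realType) (o : nat) (L : seq nat) (m k N : nat) :
  uniq L -> o \notin L -> k \in L ->
  class_count (fun=> True) (@same_side R (ext_shi o (rem k L) m.+1 k)) N ->
  class_count (fun x => lform (o, k, m.+1) x = 0)
    (@same_side R (ext_shi o L m k.+1)) N.
Proof.
move=> uL oL kL.
have ok : o != k by apply: contraNneq oL => ->.
apply: (class_count_retract (p := fun x l => if l == k then x o - m.+1%:R else x l)).
- by move=> x; rewrite /lform /= eqxx (negbTE ok); ring.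
- move=> x [[i j] c]; rewrite /ext_shi /lform /= !mem_rem_uniq // !inE.
  move=> /andP[/andP[/negbTE-> _]]; case: eqP => [->|_ /and3P[/andP[/negbTE-> _]]//].
  by rewrite (negbTE ok).
move=> x y; rewrite {1 2}/lform /= => hx hy.
have xk : x k = x o - m.+1%:R by lra.
have yk : y k = y o - m.+1%:R by lra.
split=> xy [[i j] c]; rewrite /ext_shi /= ?mem_rem_uniq // ?inE.
- move=> /andP[/andP[jk Lj]]; case: eqP => [->|/eqP io].
    have [c_le|c_gt] := leqP c (m + (k < j))%N.
      by move=> _; apply: xy; rewrite /ext_shi /= eqxx Lj.
    case: (ltngtP j k) jk c_gt => // jk _ cm c_le; last first.
      have -> : c = (m.+1 + 1)%N by lia.
      have := xy (k, j, 1%N).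
      rewrite /ext_shi /lform /= Lj kL jk [k == o]eq_sym (negbTE ok) xk yk natrD => /(_ isT).
      by lra.
    have -> : c = m.+1 by lia.
    have jo : j != o by apply: contraNneq oL => <-.
    have := xy (j, k, 0%N).
    rewrite /ext_shi /lform /= Lj kL jk (negbTE jo) xk yk => /(_ isT).
    by lra.
  move=> /and3P[/andP[_ Li] ij c1]; apply: xy.
  by rewrite /ext_shi /= (negbTE io) Lj Li ij.
- move=> /andP[Lj]; case: eqP => [->|/eqP io].
    have [->|jk] := eqVneq j k => [|c_le].
      (* These hyperplanes are parallel to the one restricted to: the form is the positive constant
         [m + 1 - c] on it. *)
      rewrite ltnn addn0 => cm; rewrite /lform /= xk yk.
      have : (c%:R : R) <= m%:R by rewrite ler_nat.
      rewrite -natr1 => cR; apply: mulr_gt0; lra.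
    apply: xy; rewrite /ext_shi /= eqxx mem_rem_uniq // !inE jk Lj /=.
    by apply: leq_trans c_le _; case: (ltngtP j k) => _; lia.
  move=> /and3P[Li ij c1].
  have [ik|ik] := eqVneq i k.
    have jk : j != k by rewrite -ik gtn_eqF.
    have := xy (o, j, (m.+1 + c)%N).
    rewrite /ext_shi /lform /= eqxx mem_rem_uniq // !inE jk Lj /= ik xk yk natrD.
    have -> : (m.+1 + c <= m.+1 + (k <= j))%N by rewrite -ik (ltnW ij) leq_add2l.
    by move=> /(_ isT); lra.
  have [jk|jk] := eqVneq j k.
    have := xy (o, i, (m.+1 - c)%N).
    rewrite /ext_shi /lform /= eqxx mem_rem_uniq // !inE ik Li /= jk xk yk natrB; last by lia.
    have -> : (m.+1 - c <= m.+1 + (k <= i))%N by lia.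
    by move=> /(_ isT); lra.
  apply: xy.
  by rewrite /ext_shi /= (negbTE io) !mem_rem_uniq // !inE jk ik Lj Li ij.
Qed.

(** On [x_o = x_k], each [x_o = x_j] with [j < k] becomes [x_j = x_k], already a Shi hyperplane.
    Here coordinate [o] becomes free, leaving the Shi arrangement on [L]. *)
Lemma shi_apex_restriction (R : realType) (o : nat) (L : seq nat) (k N : nat) :
  o \notin L -> k \in L ->
  class_count (fun=> True) (@same_side R (shi_apex o L 0)) N ->
  class_count (fun x => lform (o, k, 0%N) x = 0) (@same_side R (shi_apex o L k)) N.
Proof.
move=> oL kL.
have ok : o != k by apply: contraNneq oL => ->.
apply: (class_count_retract (p := fun x l => if l == o then x k else x l)).
- by move=> x; rewrite /lform /= eqxx eq_sym (negbTE ok); ring.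
- move=> x [[i j] c]; rewrite /shi_apex /lform /= => /andP[Lj].
  case: eqP => // io /and3P[Li _ _].
  by case: eqP => // jo; rewrite -jo Lj in oL.
move=> x y; rewrite {1 2}/lform /= => hx hy.
have xo : x o = x k by lra.
have yo : y o = y k by lra.
split=> xy [[i j] c]; rewrite /shi_apex /= => /andP[Lj]; case: eqP => // io.
  by move=> H; apply: xy; rewrite /shi_apex /= Lj; case: eqP.
- move=> /andP[jk /eqP->]; have jo : j != o by apply: contraNneq oL => <-.
  have := xy (j, k, 0%N); rewrite /shi_apex /lform /= Lj kL jk (negbTE jo) io xo yo => /(_ isT).
  by lra.
- by move=> H; apply: xy; rewrite /shi_apex /= Lj; case: eqP.
Qed.

(** * Counting by deletion-restriction *)

Lemma count_lt_S (L : seq nat) k :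
  uniq L -> count (fun j => j < k.+1)%N L = (count (fun j => j < k)%N L + (k \in L))%N.
Proof.
move=> uL; rewrite -count_uniq_mem // -count_predUI.
rewrite (@eq_count _ (predI _ _) pred0) ?count_pred0 ?addn0 => [|j /=]; last by lia.
by apply: eq_count => j /=; lia.
Qed.

(** Each index of [L] below [K] contributes one hyperplane, whose restriction again has [N]
    classes. *)
Lemma count_shi_apex (R : realType) o L N : uniq L -> o \notin L ->
  class_count (fun=> True) (@same_side R (shi_apex o L 0)) N ->
  forall K, class_count (fun=> True) (@same_side R (shi_apex o L K))
    ((count (fun j => j < K)%N L).+1 * N).
Proof.
move=> uL oL shiN; elim=> [|K IH].
  by rewrite (@eq_count _ _ pred0) // count_pred0 mul1n.
rewrite count_lt_S //; have [KL|KL] := boolP (K \in L); last first.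
  rewrite addn0; apply: eq_class_count IH => -[[i j] c]; rewrite /shi_apex /=.
  have [->|jK] := eqVneq j K; first by rewrite (negbTE KL).
  by rewrite ltnS leq_eqVlt (negbTE jK).
rewrite addn1 mulSn addnC; apply: eq_class_count (shi_apex_addition o KL) _.
apply: (deletion_restriction (@shi_apex_triples o L K)) => //=.
  by apply: contraNneq oL => ->.
exact: shi_apex_restriction.
Qed.

Lemma class_count0 (R : realType) (H : pred (nat * nat * nat)) :
  (forall h, ~~ H h) -> class_count (fun=> True) (@same_side R H) 1.
Proof.
move=> H0; have HE x y : same_side (R := R) H x y by move=> h Hh; have := H0 h; rewrite Hh.
exists unit, (fun=> fun=> 0); split=> [|i|[] []|x _ _] //.
by rewrite card_unit.
Qed.

Lemma ext_shi_top o L m K K' : (forall j, j \in L -> (j < K)%N && (j < K')%N) ->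
  ext_shi o L m K =1 ext_shi o L m K'.
Proof.
move=> LK [[i j] c]; rewrite /ext_shi /=.
have [/LK/andP[jK jK']|//] := boolP (j \in L).
by rewrite (leqNgt K) (leqNgt K') jK jK'.
Qed.

(** Induction on the length of [L], with [o], [m] and [K] free, since restriction raises [m] and the
    Shi case changes the apex. Inside it, induction on [m], and descent on [K] from a strict upper
    bound [B] of [L]. *)
Theorem count_ext_shi (R : realType) (o : nat) (L : seq nat) (m K : nat) :
  sorted ltn L -> o \notin L ->
  class_count (fun=> True) (@same_side R (ext_shi o L m K))
    ((size L + m).+1 ^ count (fun j => j < K)%N L
     * (size L + m).+2 ^ count (fun j => K <= j)%N L).
Proof.
have [n sL] := ubnP (size L); elim: n => // n IHn in L sL o m K *.
move=> sortL oL; have uL : uniq L by apply: sorted_uniq sortL; [exact: ltn_trans|exact: ltnn].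
have [B LB] : exists B, forall j, j \in L -> (j < B)%N.
  by exists (\max_(j <- L) j).+1 => j Lj; rewrite ltnS (leq_bigmax_seq _ (F := id)).
have count_ge_S k :
    count (fun j => k <= j)%N L = (count (fun j => k < j)%N L + (k \in L))%N.
  have := count_lt_S k uL.
  have := count_predC (fun j => j < k)%N L; have := count_predC (fun j => j < k.+1)%N L.
  rewrite (@eq_count _ (predC _) (fun j => k < j)%N) => [|j /=]; last by lia.
  rewrite (@eq_count _ (predC (fun j => j < k)%N) (fun j => k <= j)%N) => [|j /=]; last by lia.
  by lia.
have step m' k : class_count (fun=> True) (@same_side R (ext_shi o L m' k.+1))
    ((size L + m').+1 ^ count (fun j => j < k.+1)%N L
     * (size L + m').+2 ^ count (fun j => k.+1 <= j)%N L) ->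
  class_count (fun=> True) (@same_side R (ext_shi o L m' k))
    ((size L + m').+1 ^ count (fun j => j < k)%N L
     * (size L + m').+2 ^ count (fun j => k <= j)%N L).
  rewrite count_lt_S // (count_ge_S k); have [kL|kL] := boolP (k \in L); last first.
    rewrite !addn0; apply: eq_class_count => -[[i j] c]; rewrite /ext_shi /=.
    have [->|jk] := eqVneq j k; first by rewrite (negbTE kL).
    by rewrite (ltn_neqAle k j) [k == j]eq_sym jk.
  move=> shi1; apply: (eq_class_count (ext_shi_addition o m' kL)).
  set p := count _ _; set q := count _ _; set a := (_ + _).+1.
  (* The first summand comes from the deletion, the second from the restriction. *)
  have -> : (a ^ p * a.+1 ^ (q + 1) = a ^ (p + 1) * a.+1 ^ q + a ^ p * a.+1 ^ q)%N.
    by rewrite !addn1 !expnS mulnCA -mulnA -mulSnr.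
  apply: (deletion_restriction (@ext_shi_triples o L m' k.+1)) => //=.
    by apply: contraNneq oL => ->.
  apply: ext_shi_restriction => //.
  have perm_count P : count P L = (P k + count P (rem k L))%N.
    by have /permP-> := perm_to_rem kL.
  (* Losing the coordinate [k] and raising [m'] by one cancel, so the bases of the powers do not
     change. *)
  have sL' : (size L + m' = size (rem k L) + m'.+1)%N.
    by rewrite size_rem //; case: (L) kL => //= *; lia.
  have -> : p = count (fun j => j < k)%N (rem k L) by rewrite /p perm_count ltnn.
  have -> : q = count (fun j => k <= j)%N (rem k L).
    by apply: succn_inj; rewrite -addn1 /q -[1%N]/(true : nat) -kL -count_ge_S perm_count leqnn.
  rewrite /a sL'; apply: IHn.
  - by rewrite size_rem //; case: (L) kL sL.
  - by apply: subseq_sorted (rem_subseq k L) sortL; exact: ltn_trans.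
  - by apply: contra oL; apply: mem_rem.
(* From [B] on, all thresholds give the same arrangement; from there [step] descends to any [k]. *)
have desc m' : class_count (fun=> True) (@same_side R (ext_shi o L m' B))
    ((size L + m').+1 ^ size L) -> forall k,
  class_count (fun=> True) (@same_side R (ext_shi o L m' k))
    ((size L + m').+1 ^ count (fun j => j < k)%N L
     * (size L + m').+2 ^ count (fun j => k <= j)%N L).
  move=> topB k; have [d Bkd] : exists d, (B <= k + d)%N by exists B; rewrite leq_addl.
  elim: d k Bkd => [|d IHd] k; last by rewrite addnS -addSn => /IHd/step.
  rewrite addn0 => Bk; have Lk j : j \in L -> (j < k)%N by move=> /LB /leq_trans; apply.
  rewrite (@eq_in_count _ _ predT) => [|j /Lk->//]; rewrite count_predT.
  rewrite (@eq_in_count _ _ pred0) => [|j /Lk jk /=]; last by rewrite (leqNgt k) jk.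
  rewrite count_pred0 muln1; apply: eq_class_count topB.
  by apply: ext_shi_top => j Lj; rewrite Lk // LB.
(* At threshold [B], the arrangement for [m.+1] is the one for [m] at threshold 0, which [desc]
   supplies. *)
apply: (desc); elim: m {K} => [|m IHm]; last first.
  have := desc m IHm 0%N.
  rewrite (@eq_count _ _ pred0) // count_pred0 mul1n count_predT addnS.
  apply: eq_class_count => -[[i j] c]; rewrite /ext_shi /=.
  have [/LB jB|//] := boolP (j \in L).
  by rewrite (leqNgt B) jB addn0 addn1.
rewrite addn0; case: (L) sL sortL oL uL LB {count_ge_S step desc} => [|a L'] sL sortL oL uL LB.
  by apply: class_count0 => -[[]].
have aL' : a \notin L' by case/andP: uL.
(* As [a] is the least index, the Shi arrangement on [a :: L'] is [ext_shi a L' 0 0], which the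
   induction hypothesis counts. *)
have shi0 : class_count (fun=> True) (@same_side R (shi_apex o (a :: L') 0))
    ((size L').+2 ^ size L').
  have sortL' := path_sorted sortL.
  have := IHn L' sL a 0%N 0%N sortL' aL'.
  rewrite (@eq_count _ _ pred0) // count_pred0 mul1n count_predT addn0.
  apply: eq_class_count => -[[i j] c]; rewrite /ext_shi /shi_apex /= !inE ?ltn0 ?add0n.
  have aj k : k \in L' -> (a < k)%N.
    by move: sortL; rewrite /= path_sortedE; [case/andP=> /allP + _; apply|exact: ltn_trans].
  have [->|io] := eqVneq i o.
    move: oL; rewrite inE negb_or => /andP[/negbTE-> /negbTE->].
    by rewrite !andbF.
  have [->|ia] := eqVneq i a.
    have [->|ja] := eqVneq j a; first by rewrite ltnn (negbTE aL').
    by have [/aj->|] := boolP (j \in L').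
  have [->|ja] //= := eqVneq j a.
  rewrite (negbTE aL'); apply/negbTE; apply/and3P => -[/aj ai ia' _].
  by rewrite ltnNge ltnW in ia'.
(* Adding [x_o = x_j] for all [j] multiplies the count by [(size L').+2], the missing factor of the
   power. *)
have := count_shi_apex uL oL shi0 B.
rewrite (@eq_in_count _ _ predT) => [|j /LB->//]; rewrite count_predT -expnS.
apply: eq_class_count => -[[i j] c]; rewrite /ext_shi /shi_apex.
have [/LB jB|//] := boolP (j \in _).
by rewrite jB (leqNgt B) jB addn0 leqn0.
Qed.

(** * Regions as classes of points with equal signs *)

Definition hform (R : realType) (n : nat) (h : 'rV[R]_n * R) (x : 'rV[R]_n) : R :=
  (x *m h.1^T) 0 0 - h.2.

Lemma affine_comb_continuous (R : realType) (T : topologicalType) (I : Type)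
    (r : seq I) (f : I -> T -> R) (a : I -> R) (b : R) :
  (forall i, continuous (f i)) -> continuous (fun x => (\sum_(i <- r) f i x * a i) - b).
Proof.
move=> fc x; apply: cvgB; last exact: cvg_cst.
move: x; apply: continuous_big => [|i _ x]; first exact: add_continuous.
by apply: cvgMr_tmp; exact: fc.
Qed.

Lemma hform_continuous (R : realType) (n : nat) (h : 'rV[R]_n * R) :
  continuous (hform h).
Proof.
rewrite (_ : hform h = fun y => (\sum_j y 0 j * h.1 0 j) - h.2); last first.
  by apply/funext => y; rewrite /hform mxE; under eq_bigr do rewrite mxE.
by apply: affine_comb_continuous => j; exact: coord_continuous.
Qed.

Lemma hform_conv (R : realType) (n : nat) (h : 'rV[R]_n * R) (x y : 'rV[R]_n) (t : R) :
  hform h (x + t *: (y - x)) = (1 - t) * hform h x + t * hform h y.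
Proof.
rewrite /hform mulmxDl -scalemxAl mulmxBl; move: (x *m _) (y *m _) => a b.
by rewrite !mxE; ring.
Qed.

Lemma arr_complementP (R : realType) (n : nat) (A : seq ('rV[R]_n * R)) (x : 'rV[R]_n) :
  arr_complement A x <-> forall h, h \in A -> 0 < hform h x * hform h x.
Proof.
have hx h : 0 < hform h x * hform h x <-> ~ hyperplane h x.
  rewrite -expr2 exprn_even_gt0 //= /hform /hyperplane /= subr_eq0.
  by split => /eqP.
by split=> xA h /xA /hx.
Qed.

(** Each form is continuous and nonzero on the complement, so it maps a component to an interval
    avoiding 0 and keeps its sign there. Conversely, a segment inside the complement joins [x] to
    any point with the same signs. *)
Lemma connected_component_arr (R : realType) (n : nat) (A : seq ('rV[R]_n.+1 * R))
    (x : 'rV[R]_n.+1) : arr_complement A x ->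
  connected_component (arr_complement A) x
  = [set y | forall h, h \in A -> 0 < hform h x * hform h y].
Proof.
move=> Ax; apply/seteqP; split=> y /=.
  move=> xy h hA.
  have cC := @component_connected _ (arr_complement A) x.
  have /connected_intervalP itv : connected (hform h @` connected_component (arr_complement A) x).
    apply: connected_continuous_connected cC _.
    exact/continuous_subspaceT/hform_continuous.
  have Cn0 : ~ (hform h @` connected_component (arr_complement A) x) 0.
    move=> [z /connected_component_sub/arr_complementP/(_ h hA) + hz].
    by rewrite hz mulr0 ltxx.
  have hx : (hform h @` connected_component (arr_complement A) x) (hform h x).
    by exists x => //; exact: connected_component_refl.
  have hy : (hform h @` connected_component (arr_complement A) x) (hform h y).
    by exists y.
  rewrite ltNge; apply/negP => xy0; apply: Cn0.
  have [x0|x0] := lerP 0 (hform h x); have [y0|y0] := lerP 0 (hform h y).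
  - have /eqP : hform h x * hform h y = 0 by apply/le_anti; rewrite xy0 mulr_ge0.
    by rewrite mulf_eq0 => /orP[]/eqP <-.
  - by apply: (itv _ _ hy hx); rewrite ltW.
  - by apply: (itv _ _ hx hy); rewrite ltW.
  - by have := nmulr_rgt0 (hform h y) x0; rewrite y0 ltNge xy0.
move=> xy.
have gE : (fun t : R => x + t *: (y - x)) @` `[0, 1] `<=` connected_component (arr_complement A) x.
  apply: connected_component_max.
  - by exists 0; rewrite /= ?in_itv /= ?lexx ?ler01 // scale0r addr0.
  - move=> z [t]; rewrite /= in_itv /= => t01 <-; apply/arr_complementP => h hA.
    have := mulr_conv_gt0 t01 (xy h hA); rewrite hform_conv => p.
    by apply: (mulr_gt0_trans _ p); rewrite mulrC.
  - apply: connected_continuous_connected; first exact: segment_connected.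
    apply: continuous_subspaceT => t.
    by apply: cvgD; [exact: cvg_cst|exact: scalel_continuous].
by apply: gE; exists 1; rewrite /= ?in_itv /= ?lexx ?ler01 // scale1r addrC subrK.
Qed.

Lemma card_regions (R : realType) (n : nat) (A : seq ('rV[R]_n.+1 * R)) (N : nat) :
  class_count (fun=> True)
    (fun x y : 'rV[R]_n.+1 => forall h, h \in A -> 0 < hform h x * hform h y) N ->
  card_eq (regions A) `I_N.
Proof.
move=> [I [rep [cI repA repI repS]]].
have repC i : arr_complement A (rep i) by apply/arr_complementP; case: (repA i).
have -> : regions A = (fun i => connected_component (arr_complement A) (rep i)) @` [set: I].
  apply/seteqP; split=> C /= [x].
    move=> Ax <-; have /arr_complementP/(repS x Logic.I)[i xi] := Ax; exists i => //.
    rewrite !connected_component_arr //; apply/seteqP; split=> y /= iy h hA.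
      by apply: (mulr_gt0_trans _ (iy h hA)); exact: xi.
    by apply: (mulr_gt0_trans _ (iy h hA)); rewrite mulrC; exact: xi.
  by move=> _ <-; exists (rep x).
apply: card_eq_trans (inj_card_eq _) _.
  move=> i j _ _ ij; apply: repI.
  have := connected_component_refl (repC j); rewrite -ij.
  by rewrite connected_component_arr.
rewrite -cI; apply: card_eq_trans (card_esym (@inj_card_eq _ _ _ enum_rank _)) _.
  by move=> i j _ _; exact: enum_rank_inj.
rewrite (_ : enum_rank @` [set: I] = [set: 'I_#|I|]); first exact/card_esym/card_II.
by apply/seteqP; split=> // i _; exists (enum_val i) => //; exact: enum_valK.
Qed.

(** * Transfer to the arrangement on row vectors *)

(** Coordinate 0 is the apex and the others form [iota 1 N]. *)
Lemma mem_consts (N m k c : nat) (i j : 'I_N.+1) :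
  (c \in consts m k i j) = ext_shi 0 (iota 1 N) m k.-1 (val i, val j, c).
Proof.
rewrite /consts /ext_shi /= !mem_iota; have := ltn_ord j; have := ltn_ord i.
case: (nat_of_ord i) => [|a] aN jN /=; last first.
  by case: ifP => ?; rewrite ?inE; lia.
case: (posnP j) => j0; first by rewrite j0.
by rewrite jN; case: ltnP => ?; rewrite !inE mem_iota; lia.
Qed.

Lemma mem_arrangement (R : realType) (N m k : nat) h :
  h \in arrangement R N.+1 m k <-> exists (i j : 'I_N.+1) (c : nat),
    h = (eij R i j, c%:R) /\ ext_shi 0 (iota 1 N) m k.-1 (val i, val j, c).
Proof.
split=> [/flatten_mapP[i _ /flatten_mapP[j _ /mapP[c cm ->]]]|[i [j [c [-> ijc]]]]].
  by exists i, j, c; rewrite -mem_consts.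
apply/flatten_mapP; exists i; first by rewrite mem_enum.
apply/flatten_mapP; exists j; first by rewrite mem_enum.
by apply/map_f; rewrite mem_consts.
Qed.

Lemma hform_eij (R : realType) (n : nat) (i j : 'I_n) (c : nat) (x : nat -> R) :
  hform (eij R i j, c%:R) (\row_l x l) = lform (val i, val j, c) x.
Proof.
rewrite /hform /lform /eij /= linearB /= !trmx_delta mulmxBr mxE.
by rewrite -!colE !mxE.
Qed.

Lemma count_ltn_iota n K : count (fun j => j < K)%N (iota 1 n) = minn n K.-1.
Proof.
elim: n => [|n IHn]; first by rewrite min0n.
by rewrite -[X in iota _ X]addn1 iotaD count_cat IHn /= add1n addn0; case: ltnP => ?; lia.
Qed.

Theorem theorem4p1 (R : realType) (n m k : nat) :
  (1 <= n)%N -> (2 <= k)%N -> (k <= n.+1)%N ->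
  card_eq (regions (arrangement R n m k))
          `I_((n + m) ^ (k - 2) * (n + m + 1) ^ (n.+1 - k))%N.
Proof.
case: n => // n _ k2 kn; apply: card_regions.
(* After the case split there are [n.+1] coordinates, so the list has [n] entries and [(n + m).+1]
   is the first base. *)
have := @count_ext_shi R 0 (iota 1 n) m k.-1 (iota_ltn_sorted _ _).
rewrite mem_iota /= => /(_ isT); rewrite size_iota.
rewrite count_ltn_iota (_ : minn _ _ = k - 2)%N; last by lia.
have -> : count (fun j => k.-1 <= j)%N (iota 1 n) = (n.+2 - k)%N.
  have := count_predC (fun j => j < k.-1)%N (iota 1 n).
  rewrite size_iota count_ltn_iota (@eq_count _ _ (fun j => k.-1 <= j)%N) => [|j /=]; lia.
rewrite addn1 addSn => -[I [rep [cI repA repI repS]]].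
have rowE (x y : nat -> R) :
    (forall h, h \in arrangement R n.+1 m k ->
       0 < hform h (\row_l x l) * hform h (\row_l y l))
    <-> same_side (ext_shi 0 (iota 1 n) m k.-1) x y.
  split=> xy.
    move=> [[i j] c] ijc.
    have [iN jN] : (i < n.+1)%N /\ (j < n.+1)%N.
      move: ijc; rewrite /ext_shi /= !mem_iota; case: eqP => [->|_]; lia.
    rewrite -!(@hform_eij _ _ (Ordinal iN) (Ordinal jN)).
    apply: xy; apply/mem_arrangement.
    by exists (Ordinal iN), (Ordinal jN), c.
  by move=> _ /mem_arrangement[i [j [c [-> /xy]]]]; rewrite !hform_eij.
(* [inord] sends indices above [n] to 0, which extends a row vector to a sequence with the same
   first entries. *)
have rowK (x : 'rV[R]_n.+1) : x = \row_l x 0 (inord l).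
  by apply/rowP => l; rewrite mxE inord_val.
exists I, (fun i => \row_l rep i l); split=> // [i|i j /rowE/repI//|x _].
  by split=> //; apply/rowE; case: (repA i).
rewrite [x]rowK => /(rowE (fun l => x 0 (inord l)) (fun l => x 0 (inord l))).
by move=> /(repS _ Logic.I)[i xi]; exists i; exact/(rowE (fun l => x 0 (inord l)) (rep i)).
Qed.
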